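(* Suppose the polynomials $Q_n(x)$ are orthogonal with respect to a nondegenerate linear functional $\tau$ with moments $\tilde g_n=\langle\tau,x^n\rangle$. Let $j\ge1$ and assume that $\mu_n$ satisfies a linear recurrence relation with constant coefficients $$\alpha_0\mu_n+\alpha_1\mu_{n-1}+\dots+\alpha_{j+1}\mu_{n-j-1}=0,\qquad n\ge j+1,$$ with $\alpha_0\ne0$, $\alpha_{j+1}\neq0$, whose order $j+1$ is minimal (for $0\le M<j+1$, a relation $\sum_{i=0}^M\tilde\alpha_i\mu_{n-i}=0$ for all $n\ge M$ is possible only if all $\tilde\alpha_i=0$), and such that $\sum_{i=0}^{j+1}\alpha_i=0$. Then there exist constants $\varepsilon_{-1},\varepsilon_0,\dots,\varepsilon_j$ such that $$\tilde g_{n+j-1}=\sum_{s=-1}^j\varepsilon_s\,g_{n+j-s},\qquad n=0,1,2,\dots,$$ equivalently $$x^{j-1}\tau=\pi_{j+1}(x)\,\sigma,\qquad \pi_{j+1}(x)=\sum_{s=-1}^j\varepsilon_s x^{j-s},$$ where $\pi_{j+1}$ is a polynomial of degree at most $j+1$.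
   Context: All polynomials have complex coefficients. A linear functional on polynomials is nondegenerate if all Hankel determinants $\det|m_{i+k}|_{i,k=0}^{n-1}$, $n\ge1$, of its moments $m_n$ are nonzero. $\sigma$ is a nondegenerate linear functional with moments $g_n=\langle\sigma,x^n\rangle$, $g_0=1$, and $P_n(x)=x^n+O(x^{n-1})$ are its monic orthogonal polynomials. A generalized derivative operator $\mathcal D$ is the linear operator on polynomials with $\mathcal D x^n=\mu_n x^{n-1}$, where $\mu_n$ are complex numbers with $\mu_0=0$ and $\mu_n\neq0$ for $n\ge1$. The derived monic polynomials are $Q_n(x)=\mu_{n+1}^{-1}\mathcal D P_{n+1}(x)$, $n\ge 0$. The product of a functional $\sigma$ by a polynomial $\pi$ is defined by $\langle\pi\sigma,f\rangle=\langle\sigma,\pi f\rangle$ for all polynomials $f$. *)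

(* Defs.v *)
From HB Require Import structures.
From mathcomp Require Import all_boot all_order all_algebra.
From mathcomp Require Import reals complex.

Set Implicit Arguments.
Unset Strict Implicit.
Unset Printing Implicit Defensive.

Import Order.TTheory GRing.Theory Num.Theory.
Local Open Scope ring_scope.

Section Functionals.
Variable K : fieldType.
Implicit Types (sigma : {scalar {poly K}}) (pi : {poly K}) (P : nat -> {poly K}).

Definition moment sigma (n : nat) : K := sigma 'X^n.

Definition hankel sigma (n : nat) : 'M[K]_n :=
  \matrix_(i < n, k < n) moment sigma (i + k)%N.

Definition nondegenerate_functional sigma : Prop :=
  forall n : nat, (0 < n)%N -> \det (hankel sigma n) != 0.

(* The squared norms sigma (P n * P n) are not required to be nonzero here:
   this is automatic when sigma is nondegenerate. *)
Definition monic_orthogonal sigma P : Prop :=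
  [/\ forall n : nat, P n \is monic,
      forall n : nat, size (P n) = n.+1
    & forall m n : nat, m <> n -> sigma (P m * P n) = 0].

Definition mul_functional pi sigma (f : {poly K}) : K := sigma (pi * f).

Fact mul_functional_is_linear pi sigma : scalar (mul_functional pi sigma).
Proof. by move=> a f g; rewrite /mul_functional mulrDr -scalerAr linearP. Qed.

HB.instance Definition _ pi sigma :=
  GRing.isLinear.Build K {poly K} K *%R (mul_functional pi sigma) (mul_functional_is_linear pi sigma).

End Functionals.

Section GeneralizedDerivative.
Variable K : fieldType.
Implicit Types (mu : nat -> K) (D : {linear {poly K} -> {poly K}}).

(* For n = 0 the last clause reads D 1 = 0, since mu 0 = 0. *)
Definition generalized_derivative mu D : Prop :=
  [/\ mu 0%N = 0,
      forall n : nat, (0 < n)%N -> mu n != 0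
    & forall n : nat, D 'X^n = mu n *: 'X^(n.-1)].

Definition derived_poly mu D (P : nat -> {poly K}) (n : nat) : {poly K} :=
  (mu n.+1)^-1 *: D (P n.+1).

(* Only the values of a at 0, ..., M matter. *)
Definition linear_recurrence mu (M : nat) (a : nat -> K) : Prop :=
  forall n : nat, (M <= n)%N -> \sum_(i < M.+1) a i * mu (n - i)%N = 0.

Definition no_recurrence_below mu (N : nat) : Prop :=
  forall (M : nat) (a : nat -> K), (M < N)%N ->
    linear_recurrence mu M a -> forall i : nat, (i <= M)%N -> a i = 0.

End GeneralizedDerivative.

(* The constants epsilon_(-1), ..., epsilon_j are indexed by k = s + 1 in
   {0, ..., j + 1}, so that the exponent j - s becomes j + 1 - k. *)
Definition pi_poly (K : fieldType) (j : nat) (eps : 'I_j.+2 -> K) : {poly K} :=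
  \sum_(k < j.+2) eps k *: 'X^(j.+1 - k).

(* Main.v *)
Require Import Defs.
From mathcomp Require Import all_boot all_order all_algebra.
From mathcomp Require Import reals complex.

Set Implicit Arguments.
Unset Strict Implicit.
Unset Printing Implicit Defensive.

Import Order.TTheory GRing.Theory Num.Theory.
Local Open Scope ring_scope.

(** Orthogonality of the Q_n for tau says that f |-> tau(q D f) kills P_n as
    soon as n exceeds deg q + 1. A functional killing all P_n of large index is
    a polynomial multiple of sigma, so for each k there is T_k of degree at most
    k + 1 with tau(x^k D f) = sigma(T_k f) for every f
    ([derivative_transfer]). With f = x^(n+j-k), k <= j, this reads

      mu_(n+j-k) tau(x^(n+j-1)) = sigma(x^(j-k) T_k x^n),

    where the moment of tau on the left does not depend on k. It remains to
    find b_0, ..., b_j for which sum_k b_k mu_(n+j-k) is a nonzero constant: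
    since alpha_0 + ... + alpha_(j+1) = 0, the polynomial sum_i alpha_i z^i is
    divisible by 1 - z, and the coefficients of the quotient, the partial sums
    of alpha, do it ([partial_sum_recurrence_cst]); the constant is nonzero
    because otherwise mu would satisfy a recurrence of order j. Up to this
    constant, pi_(j+1) is sum_k b_k x^(j-k) T_k. *)

(** A monic family with one member of each degree is triangular with respect to
    the monomials, whence the induction on the degree. *)
Lemma scalar_eq0_on_triangular (K : fieldType) (L : {scalar {poly K}})
    (P : nat -> {poly K}) (n : nat) :
  (forall i, P i \is monic) -> (forall i, size (P i) = i.+1) ->
  (forall i, (i < n)%N -> L (P i) = 0) ->
  forall f : {poly K}, (size f <= n)%N -> L f = 0.
Proof.
move=> Pmon Psize; elim: n => [|n IHn] LP0 f szf.
  by move: szf; rewrite size_poly_leq0 => /eqP->; rewrite linear0.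
have -> : f = f`_n *: P n + (f - f`_n *: P n) by rewrite addrC subrK.
rewrite linearD linearZ /= LP0 // mulr0 add0r.
apply: IHn => [i lt_in|]; first by rewrite LP0 // ltnW.
apply/leq_sizeP => i; rewrite leq_eqVlt => /predU1P[<-|lt_ni].
  have := Pmon n; rewrite monicE lead_coefE Psize /= => /eqP P1.
  by rewrite coefB coefZ P1 mulr1 subrr.
rewrite coefB coefZ (leq_sizeP _ _ szf) // [(P n)`_i]nth_default ?Psize //.
by rewrite mulr0 subrr.
Qed.

Lemma monic_orthogonal_low_degree (K : fieldType) (sigma : {scalar {poly K}})
    (P : nat -> {poly K}) (n : nat) (p : {poly K}) :
  monic_orthogonal sigma P -> (size p <= n)%N -> sigma (p * P n) = 0.
Proof.
move=> [Pmon Psize Porth] szp; rewrite mulrC.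
apply: (scalar_eq0_on_triangular (L := mul_functional (P n) sigma) Pmon Psize)
  szp => i lt_in.
by apply: Porth => eq_ni; rewrite eq_ni ltnn in lt_in.
Qed.

(** The coefficients of T solve a linear system whose matrix is the N-th Hankel
    matrix. *)
Lemma nondegenerate_representation (K : fieldType) (sigma L : {scalar {poly K}})
    (N : nat) :
  nondegenerate_functional sigma -> (0 < N)%N ->
  exists2 T : {poly K}, (size T <= N)%N &
    forall i, (i < N)%N -> L 'X^i = sigma (T * 'X^i).
Proof.
move=> nd N_gt0.
have Hunit : hankel sigma N \in unitmx by rewrite unitmxE unitfE nd.
pose v := \row_(i < N) L 'X^i *m invmx (hankel sigma N).
exists (rVpoly v) => [|i lt_iN]; first exact: size_poly.
have vH : v *m hankel sigma N = \row_(i < N) L 'X^i by rewrite mulmxKV.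
have := congr1 (fun w : 'rV_N => w 0 (Ordinal lt_iN)) vH.
rewrite !mxE /= => <-.
rewrite [rVpoly v](poly_def N) mulr_suml linear_sum /=.
apply: eq_bigr => l _.
by rewrite [hankel _ _ _ _]mxE /moment valK -scalerAl linearZ /= -exprD.
Qed.

(** The Hankel system matches L and T sigma on P_0, ..., P_(N-1); on the
    remaining P_n both vanish. *)
Lemma truncated_functional_representation (K : fieldType)
    (sigma L : {scalar {poly K}}) (P : nat -> {poly K}) (N : nat) :
  nondegenerate_functional sigma -> monic_orthogonal sigma P -> (0 < N)%N ->
  (forall n, (N <= n)%N -> L (P n) = 0) ->
  exists2 T : {poly K}, (size T <= N)%N & forall f, L f = sigma (T * f).
Proof.
move=> nd Porth N_gt0 LP0; have [Pmon Psize _] := Porth.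
have [T szT TE] := nondegenerate_representation L nd N_gt0.
exists T => // f.
pose E : {scalar {poly K}} := L \- mul_functional T sigma.
suff: E f = 0 by move/eqP; rewrite /E /= subr_eq0 => /eqP.
apply: (scalar_eq0_on_triangular Pmon Psize _ (leqnn (size f))) => i _.
have [le_Ni|lt_iN] := leqP N i.
  rewrite /E /= LP0 // /mul_functional.
  by rewrite (monic_orthogonal_low_degree Porth) ?subrr // (leq_trans szT).
have szPi : (size (P i) <= N)%N by rewrite Psize.
apply: (scalar_eq0_on_triangular (P := fun n => 'X^n) _ _ _ szPi) => [n|n|n lt_nN].
- exact: monicXn.
- exact: size_polyXn.
- by rewrite /E /= TE // subrr.
Qed.

(** The P_n with n at least k + 2 are killed by f |-> tau(q D f), since D P_n is
    a multiple of Q_(n-1), whose degree exceeds that of q. *)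
Lemma derivative_transfer (K : fieldType) (sigma tau : {scalar {poly K}})
    (P : nat -> {poly K}) (mu : nat -> K) (D : {linear {poly K} -> {poly K}})
    (k : nat) (q : {poly K}) :
  nondegenerate_functional sigma -> monic_orthogonal sigma P ->
  generalized_derivative mu D -> monic_orthogonal tau (derived_poly mu D P) ->
  (size q <= k.+1)%N ->
  exists2 T : {poly K}, (size T <= k.+2)%N &
    forall f, tau (q * D f) = sigma (T * f).
Proof.
move=> nd Porth [_ mu_neq0 _] Qorth szq.
pose L : {scalar {poly K}} := mul_functional q tau \o D.
apply: (truncated_functional_representation (L := L) nd Porth) => // -[//|n] lt_kn.
have -> : L (P n.+1) = mu n.+1 * tau (q * derived_poly mu D P n).
  by rewrite /derived_poly -scalerAr linearZ mulVKf ?mu_neq0.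
by rewrite (monic_orthogonal_low_degree Qorth) ?mulr0 // (leq_trans szq).
Qed.

(** Summation by parts: with b the partial sums of alpha, the difference of two
    consecutive values of sum_i b_i mu_(n-i) is the left side of the recurrence,
    the boundary term at n - j - 1 being produced by b_(j+1) = 0. *)
Lemma partial_sum_recurrence_cst (K : fieldType) (mu alpha : nat -> K)
    (j : nat) (b := fun i => \sum_(k < i.+1) alpha k) :
  linear_recurrence mu j.+1 alpha -> \sum_(i < j.+2) alpha i = 0 ->
  forall n, \sum_(i < j.+1) b i * mu (n + j - i)%N
          = \sum_(i < j.+1) b i * mu (j - i)%N.
Proof.
move=> mu_rec alpha_sum; elim=> [//|n <-].
have := mu_rec (n.+1 + j)%N; rewrite addSn ltnS leq_addl => /(_ isT).
have bS i : b i.+1 = b i + alpha i.+1 by rewrite /b big_ord_recr.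
have alphaS i : alpha i.+1 = b i.+1 - b i by rewrite bS addrC addKr.
rewrite big_ord_recl /=.
under eq_bigr => i _ do rewrite /bump /= add1n alphaS mulrBl subSS.
rewrite sumrB addrA => /eqP; rewrite subr_eq0 => /eqP <-.
rewrite [in RHS]big_ord_recr /= [b j.+1]alpha_sum mul0r addr0.
by rewrite big_ord_recl /= {1}/b big_ord1.
Qed.

Lemma recurrence_constant_combination (K : fieldType) (mu alpha : nat -> K)
    (j : nat) :
  linear_recurrence mu j.+1 alpha -> alpha 0%N != 0 ->
  no_recurrence_below mu j.+1 -> \sum_(i < j.+2) alpha i = 0 ->
  exists beta : nat -> K,
    forall n, \sum_(i < j.+1) beta i * mu (n + j - i)%N = 1.
Proof.
move=> mu_rec alpha0 mu_min alpha_sum.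
pose b i := \sum_(k < i.+1) alpha k.
have b_cst := partial_sum_recurrence_cst mu_rec alpha_sum.
set c := \sum_(i < j.+1) b i * mu (j - i)%N in b_cst.
have c_neq0 : c != 0.
  apply: contra_neq alpha0 => c0.
  have b_rec : linear_recurrence mu j b by move=> n /subnK <-; rewrite b_cst.
  by have := mu_min j b (ltnSn j) b_rec 0%N isT; rewrite /b big_ord1.
exists (fun i => c^-1 * b i) => n.
under eq_bigr => i _ do rewrite -mulrA.
by rewrite -mulr_sumr b_cst mulVf.
Qed.

Lemma pi_poly_coef (K : fieldType) (j : nat) (p : {poly K}) :
  (size p <= j.+2)%N -> pi_poly (fun k : 'I_j.+2 => p`_(j.+1 - k)) = p.
Proof.
move=> szp; rewrite /pi_poly (reindex_inj rev_ord_inj) /=.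
under eq_bigr => i _ do rewrite subSS subKn -1?ltnS //.
by rewrite -poly_def; apply/polyP => i; rewrite coef_poly;
  case: ltnP => // le_ji; rewrite nth_default // (leq_trans szp).
Qed.

Lemma scalar_ext_Xn (K : fieldType) (L M : {scalar {poly K}}) :
  (forall n, L 'X^n = M 'X^n) -> L =1 M.
Proof.
move=> LM f; rewrite -[f]coefK poly_def !linear_sum /=.
by apply: eq_bigr => i _; rewrite !linearZ /= LM.
Qed.

(** The k-th transfer identity, k <= j, contributes x^(j-k) T_k with weight
    beta_k: the weights are those for which the factors mu_(n+j-k) add up to 1
    whatever n is. *)
Lemma polynomial_multiple_functional (K : fieldType)
    (sigma tau : {scalar {poly K}}) (P : nat -> {poly K}) (mu : nat -> K)
    (D : {linear {poly K} -> {poly K}}) (j : nat) (beta : nat -> K) :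
  nondegenerate_functional sigma -> monic_orthogonal sigma P ->
  generalized_derivative mu D -> monic_orthogonal tau (derived_poly mu D P) ->
  (1 <= j)%N ->
  (forall n, \sum_(i < j.+1) beta i * mu (n + j - i)%N = 1) ->
  exists2 p : {poly K}, (size p <= j.+2)%N &
    mul_functional 'X^(j - 1) tau =1 mul_functional p sigma.
Proof.
move=> nd Porth Dder Qorth j_gt0 beta1; have [mu0 _ DX] := Dder.
have /fin_all_exists2[T szT TE] (k : 'I_j.+1) :
    exists2 T : {poly K}, (size T <= k.+2)%N &
      forall f, tau ('X^k * D f) = sigma (T * f).
  by apply: derivative_transfer nd Porth Dder Qorth _; rewrite size_polyXn.
pose p := \sum_(k < j.+1) beta k *: ('X^(j - k) * T k).
exists p.
  apply: (leq_trans (size_sum _ _ _)); apply/bigmax_leqP => k _.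
  apply: (leq_trans (size_scale_leq _ _)); apply: (leq_trans (size_polyMleq _ _)).
  have -> : j.+2 = (j - k + k.+2)%N by rewrite !addnS subnK // -ltnS.
  by rewrite size_polyXn leq_add2l.
apply: (scalar_ext_Xn (L := mul_functional 'X^(j - 1) tau)
  (M := mul_functional p sigma)) => n; rewrite /= /mul_functional -exprD.
rewrite -[LHS]mul1r -(beta1 n) mulr_suml mulr_suml linear_sum /=.
apply: eq_bigr => k _; rewrite -scalerAl linearZ /= -mulrA; congr (_ * _).
have le_kj : (k <= j)%N by rewrite -ltnS.
rewrite mulrAC -exprD [X in sigma X]mulrC -TE DX [(j - k + n)%N]addnC addnBA //.
(* For n = 0 and k = j the exponent of the transfer identity is 0; both sides
   then vanish because mu 0 = 0. *)
case E: (n + j - k)%N => [|m]; first by rewrite mu0 mul0r scale0r mulr0 linear0.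
rewrite -scalerAr linearZ /= -exprD; congr (_ * tau 'X^_).
apply/eqP; rewrite -(eqn_add2r 1) addnAC subnK // -addnA addn1 -E.
by rewrite addnC subnKC // ?(leq_trans le_kj) ?leq_addl // addnC.
Qed.

Theorem mainTheorem8 (R : realType)
    (sigma tau : {scalar {poly R[i]}})
    (P : nat -> {poly R[i]})
    (mu : nat -> R[i])
    (D : {linear {poly R[i]} -> {poly R[i]}})
    (j : nat) (alpha : nat -> R[i])
    (sigma_nondeg : nondegenerate_functional sigma)
    (sigma_norm : moment sigma 0 = 1)
    (P_orth : monic_orthogonal sigma P)
    (D_gder : generalized_derivative mu D)
    (tau_nondeg : nondegenerate_functional tau)
    (Q_orth : monic_orthogonal tau (derived_poly mu D P))
    (j_ge1 : (1 <= j)%N)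
    (mu_rec : linear_recurrence mu j.+1 alpha)
    (alpha_first : alpha 0%N != 0)
    (alpha_last : alpha j.+1 != 0)
    (mu_min : no_recurrence_below mu j.+1)
    (alpha_sum : \sum_(i < j.+2) alpha i = 0) :
  exists eps : 'I_j.+2 -> R[i],
    [/\ forall n : nat,
          moment tau (n + j - 1)%N =
            \sum_(k < j.+2) eps k * moment sigma (n + j.+1 - k)%N,
        (size (pi_poly eps) <= j.+2)%N
      & mul_functional 'X^(j - 1) tau =1 mul_functional (pi_poly eps) sigma].
Proof.
have [beta beta1] :=
  recurrence_constant_combination mu_rec alpha_first mu_min alpha_sum.
have [p szp pE] :=
  polynomial_multiple_functional sigma_nondeg P_orth D_gder Q_orth j_ge1 beta1.
exists (fun k => p`_(j.+1 - k)); rewrite pi_poly_coef //; split=> // n.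
have := pE 'X^n; rewrite /moment /mul_functional -exprD addnC addnBA // => ->.
rewrite -{1}(pi_poly_coef szp) mulr_suml linear_sum /=.
apply: eq_bigr => k _.
by rewrite -scalerAl linearZ /= -exprD addnC addnBA // -ltnS.
Qed.
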